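(* Let $n,k,H$ be nonnegative integers with $H\le k/2$ and $n\ge1$. In the problem MinCyclic, there is an algorithm using $k$ comparison queries, at most $H$ of whose answers may be erroneous, that outputs an index $j\in\{0,\dots,n-1\}$ with \[ A[j]\ \le\ \Big\lceil \frac{n\sum_{i=0}^{H}\binom{k-H}{i}}{2^{k-H}}\Big\rceil . \]
   Context: MinCyclic: the input is an array $A[0\dots n-1]$ whose entries form an unknown cyclic rotation of $(0,1,\dots,n-1)$, i.e. there is an unknown index $x$ with $A[j]=(j-x)\bmod n$ for all $j$ (so $A[x]=0$). The algorithm adaptively asks $k$ comparison queries, each of the form ''is $x\le B$?'' for an integer $B$ of its choice; an adversary answers, and may answer incorrectly at most $H$ of the $k$ queries, where $H$ is known to the algorithm. After the $k$ answers the algorithm outputs an index $j$, aiming to make $A[j]$ as small as possible; the guarantee must hold for every $x$ and every admissible pattern of answers. *)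

(* Defs.v *)
From mathcomp Require Import all_boot all_order all_algebra.

Set Implicit Arguments.
Unset Strict Implicit.
Unset Printing Implicit Defensive.

Import Order.TTheory GRing.Theory Num.Theory.

Local Open Scope ring_scope.

Definition is_rotation (n : nat) (A : 'I_n -> nat) (x : 'I_n) : Prop :=
  forall j : 'I_n,
    (A j)%:Z = (((j : nat)%:Z - (x : nat)%:Z) %% n%:Z)%Z.

(* A deterministic adaptive algorithm asking k queries: after the answers h
   (oldest first) it asks "is x <= query h?"; after all k answers it outputs an
   index. It sees neither the array nor x, only the answers. *)
Record algorithm (n k : nat) : Type := Algorithm {
  query : seq bool -> int;
  output : k.-tuple bool -> 'I_n
}.

(* The number of false answers in the transcript a when the minimum is at x.
   The algorithm being deterministic, the transcripts with at most H errors are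
   exactly the plays of an adaptive adversary allowed H errors. *)
Definition errors (n k : nat) (alg : algorithm n k) (x : 'I_n)
    (a : k.-tuple bool) : nat :=
  #|[set i : 'I_k | tnth a i != ((x : nat)%:Z <= query alg (take i a))]|.

(* Main.v *)
(* Comparison search with lies, after Rivest, Meyer, Kleitman, Winklmann and
   Spencer. With r queries left, a position violating e of the answers weighs
   the number of ways to place at most H - e further errors among them; each of
   the first k - H queries splits the total weight almost evenly. The positions
   then still possible form few enough cells, but perhaps not an interval. If a
   cell with more than H errors separates two of them, it is queried: the sum,
   over pairwise separated cells, of (H + 1 - errors) is at most H + 1 when the
   first phase ends and loses at least 1 per query, so H further queries leave
   at most one interval. Cutting every index into k - H + 1 cells makes the
   total loss due to uneven splits less than one index. *)
Require Import Defs.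
From mathcomp Require Import all_boot all_order all_algebra.
From mathcomp Require Import zify.

Set Implicit Arguments.
Unset Strict Implicit.
Unset Printing Implicit Defensive.

Import Order.TTheory GRing.Theory Num.Theory.

Local Open Scope nat_scope.

(** * Query games and strategies *)

(* A history lists pairs (b, answer to "is c <= b?"), oldest first. *)
Definition history := seq (nat * bool).

Fixpoint wins (P : history -> Prop) (r : nat) (s : history) : Prop :=
  if r is r'.+1 then
    exists b, forall ans, wins P r' (rcons s (b, ans))
  else P s.

Fixpoint transcript (q : seq bool -> nat) (h : seq bool) : history :=
  if h is a :: h' then (q [::], a) :: transcript (fun t => q (a :: t)) h'
  else [::].

(** The strategy is glued from those obtained for the two possible answers, so no choice principle
    is needed. *)
Lemma wins_strategy P r s : wins P r s ->
  exists q, forall h, size h = r -> P (s ++ transcript q h).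
Proof.
elim: r s => [|r IHr] s /= => [Ps|[b win_b]].
  by exists (fun=> 0) => h /size0nil ->; rewrite cats0.
have [qt Hqt] := IHr _ (win_b true); have [qf Hqf] := IHr _ (win_b false).
exists (fun h => if h is a :: h' then (if a then qt else qf) h' else b).
case=> [//|[] h] [sz_h] /=; rewrite -cat_rcons.
  exact: Hqt.
exact: Hqf.
Qed.

Lemma wins_stable (P : history -> Prop) r s :
  (forall t p, P t -> P (rcons t p)) -> P s -> wins P r s.
Proof.
move=> stableP; elim: r s => [//|r IHr] s Ps /=.
by exists 0 => ans; apply/IHr/stableP.
Qed.

(** * Errors charged to a cell *)

Definition err (s : history) (c : nat) : nat :=
  count (fun p => p.2 != (c <= p.1)) s.

Lemma err_rcons s p c : err (rcons s p) c = err s c + (p.2 != (c <= p.1)).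
Proof. by rewrite /err -cats1 count_cat /= addn0. Qed.

Lemma err_transcript q h c :
  err (transcript q h) c =
  \sum_(i < size h) (nth false h i != (c <= q (take i h))).
Proof.
elim: h q => [|a h IHh] q; first by rewrite big_ord0.
by rewrite big_ord_recl -(IHh (fun t => q (a :: t))).
Qed.

(** Errors are split by the answer given because each kind is monotone in the cell. *)
Definition false_yes (s : history) c := count (fun p => p.2 && (p.1 < c)) s.
Definition false_no (s : history) c := count (fun p => ~~ p.2 && (c <= p.1)) s.

Lemma err_split s c : err s c = false_yes s c + false_no s c.
Proof.
elim: s => [//|[b ans] s]; rewrite /err /false_yes /false_no /= => ->.
by rewrite ltnNge; case: ans; case: (c <= b) => /=; lia.
Qed.

Lemma leq_false_yes s c c' : c <= c' -> false_yes s c <= false_yes s c'.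
Proof.
by move=> cc'; apply: sub_count => p /= /andP[-> /leq_trans->].
Qed.

Lemma leq_false_no s c c' : c <= c' -> false_no s c' <= false_no s c.
Proof.
by move=> cc'; apply: sub_count => p /= /andP[-> /(leq_trans cc')->].
Qed.

Section LieSearch.

Variables H N : nat.

(** * Second phase: separated cells and slack *)

Definition separated (s : history) c c' : bool :=
  [exists g : 'I_c', (c < g) && (H < err s g)].

Lemma separatedP s c c' :
  reflect (exists2 g, c < g < c' & H < err s g) (separated s c c').
Proof.
apply: (iffP existsP) => [[g /andP[cg gd]]|[g /andP[cg gc'] gd]].
  by exists g; rewrite ?cg //=.
by exists (Ordinal gc'); rewrite cg.
Qed.

Lemma separated_trans s : transitive (separated s).
Proof.
move=> c2 c1 c3 /separatedP[g /andP[lt1 lt2] gd] /separatedP[g' /andP[lt3 lt4] _].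
by apply/separatedP; exists g => //; rewrite lt1 /=; lia.
Qed.

Definition slack (s : history) (cs : seq nat) : nat :=
  \sum_(c <- cs) (H.+1 - err s c).

(** A separating [g] between [c] and [c2] has at least [H.+1] errors; its false yeses also count at
    [c2], its false noes at [c]. So the term of [c2] plus [false_no s c2] is at most
    [false_no s c]. *)
Lemma slack_path s c cs : path (separated s) c cs -> slack s cs <= false_no s c.
Proof.
elim: cs c => [|c2 cs IHcs] c; first by rewrite /slack big_nil.
case/andP=> /separatedP[g /andP[cg gc2] gd] /IHcs.
rewrite /slack big_cons.
have := leq_false_no s (ltnW cg); have := leq_false_no s (ltnW gc2).
have := leq_false_yes s (ltnW gc2); move: gd; rewrite !err_split; lia.
Qed.

Definition alive (s : history) c : bool := err s c <= H.

(** Separation is fixed at [s0], the end of the first phase, so that later queries create no new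
    chains. *)
Definition chain (s0 s : history) (cs : seq nat) : bool :=
  sorted (separated s0) cs && all (alive s) cs.

Lemma slack_chain s cs : chain s s cs -> slack s cs <= H.+1.
Proof.
case: cs => [|c cs]; first by rewrite /slack big_nil.
case/andP=> /= /slack_path; rewrite /slack big_cons => le_no /andP[].
by move: le_no; rewrite /alive err_split; lia.
Qed.

Lemma slack_mono s p cs : slack (rcons s p) cs <= slack s cs.
Proof. by apply: leq_sum => c _; rewrite err_rcons; lia. Qed.

Lemma slack_drop s p cs c : c \in cs -> err s c <= H ->
  p.2 != (c <= p.1) -> slack (rcons s p) cs < slack s cs.
Proof.
move=> c_cs c_alive bad; rewrite /slack !(big_rem c c_cs) /= err_rcons bad.
have := slack_mono s p (rem c cs); rewrite /slack; lia.
Qed.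

Lemma alive_rcons s p c : alive (rcons s p) c -> alive s c.
Proof. by rewrite /alive err_rcons; lia. Qed.

(* Either the answer is false at some element of cs, which lowers the slack, or
   cs lies on one side of g and can be extended by c or c' on the other side. *)
Lemma chain_query s0 s c g c' ans r cs :
  (forall cs', chain s0 s cs' -> slack s cs' <= r.+2) ->
  (forall d, alive s d -> alive s0 d) ->
  alive s c -> alive s c' -> c < g < c' -> H < err s0 g ->
  chain s0 (rcons s (g, ans)) cs -> slack (rcons s (g, ans)) cs <= r.+1.
Proof.
move=> bnd alive_s0 c_al c'_al /andP[cg gc'] gd /andP[cs_sorted cs_al].
have cs_al' : all (alive s) cs by apply: sub_all cs_al => d /alive_rcons.
have g_dead : ~~ alive s g by apply: contraL gd => /alive_s0; rewrite -leqNgt.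
have [/hasP[d d_cs bad]|] :=
    boolP (has (fun d => ans != (d <= g)) cs).
  rewrite -ltnS; apply: leq_trans (bnd cs _); last by rewrite /chain cs_sorted.
  by apply: (@slack_drop s (g, ans)) d_cs (allP cs_al' _ d_cs) bad.
rewrite -all_predC => /allP /= good.
apply: leq_trans (slack_mono _ _ _) _.
have good' d : d \in cs -> ans = (d <= g) by move/good; rewrite negbK => /eqP.
have neq_g d : d \in cs -> d != g.
  by move=> /(allP cs_al'); apply: contraTneq => ->.
case: ans good' {good cs_al} => good.
  have sep d : d \in cs -> separated s0 d c'.
    move=> d_cs; apply/separatedP; exists g => //.
    by rewrite gc' ltn_neqAle neq_g //= -good.
  have := bnd (rcons cs c').
  rewrite /chain /slack big_rcons all_rcons c'_al cs_al' /=.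
  rewrite (_ : sorted _ _) => [/(_ isT)|]; first by move: c'_al; rewrite /alive; lia.
  case: (lastP cs) cs_sorted sep => // cs1 d; rewrite -!cats1.
  case: cs1 => [|d1 cs1] /=; first by move=> _ ->; rewrite ?mem_head.
  rewrite !cat_path /= !andbT last_cat /= => /andP[-> ->] -> //.
  by rewrite inE mem_cat inE eqxx !orbT.
have sep d : d \in cs -> separated s0 c d.
  move=> d_cs; apply/separatedP; exists g => //.
  by rewrite cg ltnNge -good.
have := bnd (c :: cs); rewrite /chain /slack big_cons /= c_al cs_al' andbT.
rewrite (_ : path _ _ _) => [/(_ isT)|]; first by move: c_al; rewrite /alive; lia.
by case: cs cs_sorted sep {bnd cs_al' good neq_g} => //= d cs -> ->; rewrite ?mem_head.
Qed.

(** * Closing the gaps *)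

Definition fits (Q T : nat) (s : history) : Prop :=
  forall c c', c <= c' -> c' < N -> alive s c -> alive s c' -> Q * (c' - c) < T.

Lemma fits_rcons Q T s p : fits Q T s -> fits Q T (rcons s p).
Proof. by move=> fitP c c' cc' c'N /alive_rcons ? /alive_rcons; apply: fitP. Qed.

(** No cell between them has more than [H] errors, so all [c' - c + 1] cells from [c] to [c'] are
    counted. *)
Lemma alive_interval s c c' : c <= c' -> c' < N -> ~~ separated s c c' ->
  alive s c -> alive s c' -> c' - c < \sum_(i < N) alive s i.
Proof.
move=> cc' c'N nsep c_al c'_al.
have all_al d : c <= d <= c' -> alive s d.
  case/andP=> cd dc'; apply: contraR nsep; rewrite -ltnNge => d_dead.
  apply/separatedP; exists d => //; rewrite !ltn_neqAle cd dc' !andbT.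
  apply/andP; split; first by apply: contraTneq d_dead => <-; rewrite -leqNgt.
  by apply: contraTneq d_dead => ->; rewrite -leqNgt.
rewrite -(big_mkord xpredT (fun i => nat_of_bool (alive s i))).
rewrite (@big_cat_nat _ _ _ c) //=; last by lia.
rewrite (@big_cat_nat _ _ _ c'.+1 c) //=; last by lia.
rewrite (@eq_big_nat _ _ _ c c'.+1 _ (fun=> 1)) => [|d d_in]; last first.
  by rewrite all_al.
by rewrite sum_nat_const_nat; lia.
Qed.

Lemma separated_or_fits Q T s0 s : 0 < Q ->
  Q * (\sum_(c < N) alive s0 c) <= T ->
  (forall d, alive s d -> alive s0 d) ->
  (exists c c', [&& alive s c, alive s c' & separated s0 c c']) \/ fits Q T s.
Proof.
move=> Q_gt0 le_T sub.
have [/existsP[[c c'] sep]|nosep] :=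
  boolP [exists p : 'I_N * 'I_N,
    [&& alive s p.1, alive s p.2 & separated s0 p.1 p.2]].
  by left; exists c, c'.
right=> c c' cc' c'N c_al c'_al; apply: leq_trans le_T.
rewrite ltn_pmul2l // alive_interval ?sub //.
apply: contra nosep => sep; apply/existsP.
exists (Ordinal (leq_ltn_trans cc' c'N), Ordinal c'N).
by rewrite /= c_al c'_al.
Qed.

Lemma wins_gaps Q T s0 s r : 0 < Q ->
  Q * (\sum_(c < N) alive s0 c) <= T ->
  (forall d, alive s d -> alive s0 d) ->
  (forall cs, chain s0 s cs -> slack s cs <= r.+1) ->
  wins (fits Q T) r s.
Proof.
move=> Q_gt0 le_T; elim: r s => [|r IHr] s sub bnd;
  have [[c [c' /and3P[c_al c'_al sep]]]|] := separated_or_fits Q_gt0 le_T sub.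
(* Two separated alive cells have slack at least 2, against the bound 1 once no query remains. *)
- have := bnd [:: c; c'].
  rewrite /chain /slack !big_cons big_nil /= sep c_al c'_al => /(_ isT).
  by move: c_al c'_al; rewrite /alive; lia.
- by [].
- have /separatedP[g g_in g_dead] := sep; exists g => ans.
  apply: IHr => [d /alive_rcons/sub|cs] //.
  exact: (chain_query bnd sub c_al c'_al g_in g_dead).
- by apply: wins_stable => t p; apply: fits_rcons.
Qed.

(** * First phase: halving the weight *)

(* The truncated subtraction makes the weight 0 as soon as e > H. *)
Definition weight r e : nat := \sum_(i < H.+1 - e) 'C(r, i).

(** Pascal's rule: the next answer is either true at the cell or adds an error. *)
Lemma weightS r e : weight r.+1 e = weight r e + weight r e.+1.
Proof.
rewrite /weight subSS.
case: (ltnP H e) => [lt_He|le_eH].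
  have [-> ->] : H.+1 - e = 0 /\ H - e = 0 by lia.
  by rewrite !big_ord0.
rewrite subSn // !big_ord_recl /= !bin0 -addnA -big_split /=; congr (_ + _).
Qed.

Lemma weight0 e : weight 0 e = (e <= H).
Proof.
rewrite /weight; case: leqP => [le_eH|lt_He].
  by rewrite subSn // big_ord_recl bin0 big1 ?addn0.
have -> : H.+1 - e = 0 by lia.
by rewrite big_ord0.
Qed.

Lemma weight_leS r e : weight r e.+1 <= weight r e.
Proof.
rewrite /weight; case: (ltnP H e) => [lt_He|le_eH].
  have -> : H.+1 - e.+1 = 0 by lia.
  by rewrite big_ord0.
by rewrite (subSn le_eH) subSS big_ord_recr leq_addr.
Qed.

(** The difference is at most one binomial coefficient of row [r]. *)
Lemma weight_leD r e : weight r e <= weight r e.+1 + 2 ^ r.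
Proof.
rewrite /weight; case: (ltnP H e) => [lt_He|le_eH].
  have -> : H.+1 - e = 0 by lia.
  by rewrite big_ord0.
rewrite (subSn le_eH) subSS big_ord_recr leq_add2l.
case: (leqP (H - e) r) => [le_r|/bin_small->//].
rewrite -[2]/(1 + 1) expnDn.
rewrite (bigD1 (Ordinal (le_r : H - e < r.+1))) //= !exp1n !muln1.
exact: leq_addr.
Qed.

Definition total r s : nat := \sum_(c < N) weight r (err s c).

(** The cut [b] is the first whose prefix sum of [d] reaches half of the whole; it overshoots by at
    most one term, and each term is at most [2 ^ r]. *)
Lemma balanced_query r s : 0 < N ->
  exists b, forall ans,
    2 * total r (rcons s (b, ans)) <= total r.+1 s + 2 ^ r.+1.
Proof.
move=> N_gt0.
pose d c := weight r (err s c) - weight r (err s c).+1.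
pose P t := \sum_(0 <= c < t) d c.
have : exists b, P N <= 2 * P b.+1 by exists N.-1; rewrite prednK //; lia.
case/ex_minnP=> b bP b_min; exists b.
have le_bN : b < N.
  by rewrite -(prednK N_gt0) ltnS; apply: b_min; rewrite prednK //; lia.
have Pb : 2 * P b <= P N.
  case: b b_min {bP le_bN} => [|b] b_min; first by rewrite /P big_geq.
  by rewrite leqNgt; apply/negP => /ltnW/b_min; rewrite ltnn.
have Pb1 : P b.+1 <= P b + 2 ^ r.
  rewrite /P big_nat_recr //= leq_add2l /d leq_subLR; exact: weight_leD.
(* [S] is the total left if the answer were false at every cell; being true at [c] restores
   [d c]. *)
pose S := \sum_(0 <= c < N) weight r (err s c).+1.
have tot : total r.+1 s = 2 * S + P N.
  rewrite /total -(big_mkord xpredT (fun c => weight r.+1 (err s c))).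
  rewrite mul2n -addnn -addnA /S /P -!big_split /=; apply: eq_bigr => c _.
  by rewrite weightS /d; have := weight_leS r (err s c); lia.
have tot_rcons ans : total r (rcons s (b, ans)) =
    S + \sum_(0 <= c < N | ans == (c <= b)) d c.
  rewrite /total -(big_mkord xpredT (fun c => weight r (err (rcons s _) c))).
  rewrite [X in _ + X]big_mkcond -big_split /=; apply: eq_bigr => c _.
  rewrite err_rcons /d /=; case: eqP => _ /=; rewrite ?addn1 ?addn0 //.
  by rewrite addnC subnK // weight_leS.
have lo : \sum_(0 <= c < N | c <= b) d c = P b.+1.
  by rewrite /P [RHS](@big_nat_widen _ _ _ 0 b.+1 N).
have hi : P b.+1 + \sum_(0 <= c < N | ~~ (c <= b)) d c = P N.
  by rewrite -lo [RHS](bigID (fun c => c <= b)).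
case; rewrite tot_rcons tot expnS.
  by under eq_bigl => c do rewrite eq_sym eqb_id; rewrite lo; lia.
by under eq_bigl => c do rewrite eq_sym eqbF_neg; lia.
Qed.

(** [q] doubles where the total would halve, so [q * 2 ^ r] and [T] stay constant; [r * 2 ^ r] pays
    for the uneven splits still to come. *)
Lemma wins_weight T q r s : 0 < N -> 0 < q ->
  q * (total r s + r * 2 ^ r) <= T -> wins (fits (q * 2 ^ r) T) (r + H) s.
Proof.
move=> N_gt0; elim: r q s => [|r IHr] q s q_gt0 le_T; last first.
  have [b Hb] := balanced_query r s N_gt0; exists b => ans.
  rewrite expnS mulnA; apply: IHr; first by lia.
  apply: leq_trans le_T; rewrite -mulnA leq_mul2l; apply/orP; right.
  have := Hb ans; rewrite expnS; lia.
(* At [r = 0] the total counts the alive cells, and the [H] queries left match the slack bound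
   [H.+1]. *)
rewrite muln1 add0n; apply: (@wins_gaps _ _ s) => //.
  apply: leq_trans le_T; rewrite mul0n addn0 leq_mul2l /total.
  by under [X in _ || (_ <= X)]eq_bigr => c do rewrite weight0; rewrite leqnn orbT.
exact: slack_chain.
Qed.

End LieSearch.

(** * Return to the cyclic array *)

Lemma rotation_value n (A : 'I_n -> nat) (x j : 'I_n) :
  is_rotation A x -> x <= j -> A j = j - x.
Proof.
move=> /(_ j) Aj le_xj; apply/eqP; rewrite -eqz_nat; apply/eqP.
rewrite Aj -subzn // modz_small //; have := ltn_ord j; lia.
Qed.

Local Open Scope ring_scope.

Theorem theorem4 (n k H : nat) (n_ge1 : (1 <= n)%N)
    (H_le : H%:R <= k%:R / 2 :> rat) :
  exists alg : algorithm n k,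
    forall (A : 'I_n -> nat) (x : 'I_n), is_rotation A x ->
    forall a : k.-tuple bool, (errors alg x a <= H)%N ->
      (A (output alg a))%:Z <=
        Num.ceil (n%:R * (\sum_(0 <= i < H.+1) 'C(k - H, i)%:R)
                    / 2 ^+ (k - H) : rat).
Proof.
have le_Hk : (H <= k)%N.
  by move: H_le; rewrite ler_pdivlMr // -natrM ler_nat; lia.
pose m := (k - H)%N; pose D := m.+1.
pose B := (\sum_(0 <= i < H.+1) 'C(m, i))%N.
pose T := (n * D * B + m * 2 ^ m)%N.
have : wins (fits H (n * D) (1 * 2 ^ m) T) (m + H) [::].
  apply: wins_weight; rewrite ?muln_gt0 ?n_ge1 // mul1n /total.
  rewrite (eq_bigr (fun=> weight H m 0)) // big_const_ord iter_addn_0 mulnC.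
  rewrite /weight subn0.
  by rewrite -(big_mkord xpredT (fun i => 'C(m, i))).
rewrite mul1n subnK // => /wins_strategy[q q_fits].
(* Index [j] is represented by the cell [j * D]; comparing it with [q h] amounts to comparing [j]
   with [q h %/ D]. *)
pose ok (a : seq bool) (j : 'I_n) := alive H (transcript q a) (j * D).
(* The score [j.+1], against 0, lets even index 0 beat every excluded one, so the maximum is the
   last index still possible. *)
pose out (a : k.-tuple bool) :=
  [arg max_(j > Ordinal n_ge1) (if ok a j then j.+1 else 0%N)].
exists (Algorithm (fun h => (q h %/ D)%:Z) out) => A x rotA a err_a.
have err_x : ok a x.
  apply: leq_trans err_a; rewrite err_transcript size_tuple /errors -sum1_card.
  rewrite [leqRHS]big_mkcond /=; apply: leq_sum => i _.
  by rewrite inE (tnth_nth false) /= lez_nat leq_divRL //; case: eqP.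
have [j_ok le_xj] : ok a (out a) /\ (x <= out a)%N.
  rewrite /out; case: arg_maxnP => // j _ /(_ x isT); rewrite err_x.
  by case: (ok a j).
rewrite /= (rotation_value rotA le_xj).
have jD_lt : (out a * D < n * D)%N by rewrite ltn_pmul2r.
have := q_fits a (size_tuple a) _ _ (leq_mul le_xj (leqnn D)) jD_lt err_x j_ok.
rewrite -mulnBl => lt_T.
(* Dividing by [D = m.+1] turns the loss [m * 2 ^ m] into less than [2 ^ m]. *)
have {lt_T} : ((out a - x) * 2 ^ m < n * B + 2 ^ m)%N.
  rewrite -(ltn_pmul2r (ltn0Sn m)) -/D; apply: leq_trans (_ : T <= _)%N.
    by move: lt_T; rewrite mulnCA mulnA.
  rewrite /T mulnDl -/D mulnAC leq_add2l mulnC leq_mul2l; lia.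
rewrite -(ltr_nat rat) natrM natrD natrM natrX natr_sum -/m.
set S := \sum_(_ <= _ < _) _; set M := _ / _ => lt_M.
(* For an integer it suffices to lie strictly below the ceiling plus 1, which is at least
   [M + 1]. *)
rewrite -ltzD1 -(ltr_int rat) rmorphD /=.
apply: (@lt_le_trans _ _ (M + 1)); last by rewrite lerD2r ceil_ge.
rewrite -(ltr_pM2r (_ : 0 < 2 ^+ m)) ?exprn_gt0 //.
by rewrite mulrDl mul1r mulfVK ?expf_neq0.
Qed.
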